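(* Let $p\geqslant1$ be a real number and $n\geqslant1$. Then $F_n(x,p)=\sum_{\sigma\in\mathcal{S}^B_n}x^{\mathrm{fexc}(\sigma)}p^{\mathrm{neg}(\sigma)}$, a polynomial in $x$ of degree $2n-1$, is bi-$\gamma$-positive, i.e. there are nonnegative reals $\xi_k,\eta_k$ with $$F_n(x,p)=\sum_{k=0}^{n-1}\xi_kx^k(1+x)^{2n-1-2k}+x\sum_{k=0}^{n-1}\eta_kx^k(1+x)^{2n-2-2k},$$ and consequently $F_n(x,p)$ is alternatingly increasing: writing $F_n(x,p)=\sum_{\ell=0}^{2n-1}f_\ell x^\ell$, one has $f_0\leqslant f_{2n-1}\leqslant f_1\leqslant f_{2n-2}\leqslant\cdots\leqslant f_n$.
   Context: $\mathcal{S}^B_n$ is the group of bijections $\sigma$ of $\{\pm1,\dots,\pm n\}$ with $\sigma(-i)=-\sigma(i)$. For $\sigma\in\mathcal{S}^B_n$: $\mathrm{exc}_A(\sigma)=\#\{i\in[n]:\sigma(i)>i\}$, $\mathrm{neg}(\sigma)=\#\{i:\sigma(i)<0\}$, $\mathrm{fexc}(\sigma)=2\,\mathrm{exc}_A(\sigma)+\mathrm{neg}(\sigma)$. *)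

(* Defs.v *)
From HB Require Import structures.
From mathcomp Require Import all_boot all_order all_algebra all_fingroup.
From mathcomp Require Import reals.

Set Implicit Arguments.
Unset Strict Implicit.
Unset Printing Implicit Defensive.

Import Order.TTheory GRing.Theory Num.Theory.

Local Open Scope ring_scope.

(* The set {+-1, ..., +-n}: (false, i) stands for i + 1 and (true, i) for
   - (i + 1), ordinals being numbered from 0; [pm_val] is the integer meant. *)
Definition pm (n : nat) : finType := (bool * 'I_n)%type.

Definition pm_val (n : nat) (a : pm n) : int := (-1) ^+ a.1 * (a.2.+1)%:Z.

Definition pm_opp (n : nat) (a : pm n) : pm n := (~~ a.1, a.2).

Definition pm_pos (n : nat) (i : 'I_n) : pm n := (false, i).

Lemma pm_val_inj (n : nat) : injective (@pm_val n).
Proof.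
move=> [[] i] [[] j]; rewrite /pm_val /= ?expr1 ?expr0 ?mulN1r ?mul1r.
- by move/oppr_inj => [ij]; congr (_, _); apply: val_inj.
- by [].
- by [].
- by move=> [ij]; congr (_, _); apply: val_inj.
Qed.

Lemma pm_val_opp (n : nat) (a : pm n) : pm_val (pm_opp a) = - pm_val a.
Proof. by case: a => [[] i]; rewrite /pm_val /= ?expr1 ?expr0 !mulN1r ?mul1r ?opprK. Qed.

Lemma pm_valP (n : nat) (z : int) :
  reflect (exists a : pm n, pm_val a = z) (0 < `|z| <= n)%N.
Proof.
apply: (iffP andP) => [[z0 zn]|[[b i] <-]]; last first.
  by rewrite /pm_val abszMsign /= ltn_ord.
have zi : (`|z|.-1 < n)%N by rewrite prednK.
exists (z < 0, Ordinal zi).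
by rewrite /pm_val /= prednK // [RHS]intEsign.
Qed.

Definition signed_perm (n : nat) : {set {perm pm n}} :=
  [set s : {perm pm n} | [forall a, s (pm_opp a) == pm_opp (s a)]].

Lemma signed_perm_group_set (n : nat) : group_set (signed_perm n).
Proof.
apply/group_setP; split=> [|s t].
  by rewrite inE; apply/forallP=> a; rewrite !perm1.
rewrite !inE => /forallP hs /forallP ht; apply/forallP=> a.
by rewrite !permM (eqP (hs a)) (eqP (ht _)).
Qed.

Canonical signed_perm_group (n : nat) := Group (signed_perm_group_set n).

Definition exc_A (n : nat) (s : {perm pm n}) : nat :=
  #|[set i : 'I_n | pm_val (pm_pos i) < pm_val (s (pm_pos i))]|.

Definition neg (n : nat) (s : {perm pm n}) : nat :=
  #|[set i : 'I_n | pm_val (s (pm_pos i)) < 0]|.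

Definition fexc (n : nat) (s : {perm pm n}) : nat := (2 * exc_A s + neg s)%N.

Definition fexc_poly (R : realType) (n : nat) (p : R) : {poly R} :=
  \sum_(s in signed_perm n) p ^+ neg s *: 'X^(fexc s).

(* Main.v *)
Require Import Defs.
From HB Require Import structures.
From mathcomp Require Import all_boot all_order all_algebra all_fingroup.
From mathcomp Require Import reals ring lra zify.

Set Implicit Arguments.
Unset Strict Implicit.
Unset Printing Implicit Defensive.

Import Order.TTheory GRing.Theory Num.Theory.

Local Open Scope ring_scope.

(* A letter moved upwards by the underlying permutation contributes
   [a = X^2 + p X] (one term for each sign), any other letter [b = 1 + p X], so
   [F_n] is the homogeneous Eulerian polynomial [P_n(a, b)].  Inserting the new
   largest letter into a cycle gives [P_(n+1) = b P_n + D P_n] for the derivation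
   [D a = D b = a b]; writing [P_(n+1) = b Q_n] this becomes
   [Q_(n+1) = v Q_n + D Q_n] with [u = a b], [v = a + b], [D u = u v],
   [D v = 2 u], whence [Q_n] is a polynomial in [u] and [v] with nonnegative
   coefficients.  Here [u = X (p (1 + X)^2 + (p - 1)^2 X)] and
   [v = (1 + X)^2 + 2 (p - 1) X], so [Q_n] is gamma-positive when [p >= 1], and
   [b = (1 + X) + (p - 1) X] splits [F_n = b Q_n] into the two required parts. *)

(** * The homogeneous Eulerian polynomial and its recurrence by cycle insertion *)

Definition exc_weight (A : comNzRingType) (a b : A) (n : nat) (w : 'S_n)
    (i : 'I_n) : A :=
  if (i < w i)%N then a else b.

Definition eulerian_hom (A : comNzRingType) (n : nat) (a b : A) : A :=
  \sum_(w : 'S_n) \prod_i exc_weight a b w i.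

(* Inserts [ord_max] after [i] in its cycle; [i = ord_max] adds a fixed point. *)
Definition cycle_insert (n : nat) (iw : 'I_n.+1 * 'S_n) : 'S_n.+1 :=
  (tperm iw.1 ord_max * lift_perm ord_max ord_max iw.2)%g.

(** The inserted index is the preimage of [ord_max]; once it is known, the transposition cancels. *)
Lemma cycle_insert_inj (n : nat) : injective (@cycle_insert n).
Proof.
move=> [i w] [j v] e.
have ei : i = j.
  have max_ (k : 'I_n.+1) (u : 'S_n) : cycle_insert (k, u) k = ord_max.
    by rewrite permM tpermL lift_perm_id.
  by apply: (@perm_inj _ (cycle_insert (j, v))); rewrite max_ -e max_.
subst j; congr (_, _); move/mulgI: e => /= e.
apply/permP=> k; apply: (@lift_inj _ ord_max).
by rewrite -!(lift_perm_lift ord_max) e.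
Qed.

Lemma cycle_insert_bij (n : nat) : bijective (@cycle_insert n).
Proof.
apply: inj_card_bij; first exact: cycle_insert_inj.
by rewrite card_prod card_ord !card_Sn factS.
Qed.

Lemma prod_cycle_insert_max (A : comNzRingType) (a b : A) (n : nat) (w : 'S_n) :
  \prod_i exc_weight a b (cycle_insert (ord_max, w)) i =
  b * \prod_i exc_weight a b w i.
Proof.
rewrite big_ord_recr /= mulrC; congr (_ * _).
  by rewrite /exc_weight permM tpermL lift_perm_id ltnn.
apply: eq_bigr => i _; rewrite /exc_weight permM tperm1 perm1.
have -> : widen_ord (leqnSn n) i = lift ord_max i.
  by apply: ord_inj; rewrite lift_max.
by rewrite lift_perm_lift !lift_max.
Qed.

(** Now [i] goes up to [ord_max] (weight [a]) and [ord_max] goes down to [w i] (weight [b]), so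
    [a * b] replaces the weight of [i]: the derivation applied to that factor. *)
Lemma prod_cycle_insert_lift (A : comNzRingType) (a b : A) (n : nat) (w : 'S_n)
    (i : 'I_n) :
  \prod_j exc_weight a b (cycle_insert (lift ord_max i, w)) j =
  a * b * \prod_(j | j != i) exc_weight a b w j.
Proof.
have widE (j : 'I_n) : widen_ord (leqnSn n) j = lift ord_max j.
  by apply: ord_inj; rewrite lift_max.
rewrite big_ord_recr /= (bigD1 i) //= widE mulrAC; congr (_ * _ * _).
- by rewrite /exc_weight permM tpermL lift_perm_id lift_max ltn_ord.
- rewrite /exc_weight permM tpermR lift_perm_lift lift_max.
  by rewrite ltnNge ltnW.
apply: eq_bigr => j ji; rewrite /exc_weight widE permM tpermD ?lift_perm_lift ?lift_max //.
  by rewrite (inj_eq lift_inj) eq_sym.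
by rewrite neq_lift.
Qed.

Lemma deriv_prod (A : comNzRingType) (I : finType) (f : I -> {poly A}) :
  (\prod_i f i)^`() = \sum_i (f i)^`() * \prod_(j | j != i) f j.
Proof.
suff main (s : seq I) : uniq s -> (\prod_(i <- s) f i)^`() =
    \sum_(i <- s) (f i)^`() * \prod_(j <- s | j != i) f j.
  by rewrite main // index_enum_uniq.
elim: s => [|i s IHs] /=; first by rewrite !big_nil derivC.
case/andP=> is_ us; rewrite !big_cons derivM IHs // eqxx /=; congr (_ + _).
  congr (_ * _); rewrite big_seq [RHS]big_seq_cond; apply: eq_bigl => j.
  by case: (boolP (j \in s)) => // js; apply/esym; apply: contraNneq is_ => <-.
rewrite mulr_sumr big_seq [RHS]big_seq; apply: eq_bigr => j js.
rewrite big_cons ifT 1?mulrCA //.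
by apply: contraNneq is_ => ->.
Qed.

Lemma horner_line0 (A : comNzRingType) (a c : A) : (a%:P + c *: 'X).[0] = a.
Proof. by rewrite hornerD hornerC hornerZ hornerX mulr0 addr0. Qed.

Lemma deriv_line (A : comNzRingType) (a c : A) : (a%:P + c *: 'X)^`() = c%:P.
Proof. by rewrite derivD derivC derivZ derivX add0r alg_polyC. Qed.

(* The derivation with value [a b] on both [a] and [b] is the derivative at 0
   along the line of direction [(a b, a b)], which makes sense in every
   commutative ring. *)
Lemma eulerian_homS (A : comNzRingType) (n : nat) (a b : A) :
  eulerian_hom n.+1 a b =
  b * eulerian_hom n a b +
  (eulerian_hom n (a%:P + (a * b) *: 'X) (b%:P + (a * b) *: 'X))^`().[0].
Proof.
rewrite {1}/eulerian_hom (reindex _ (onW_bij _ (@cycle_insert_bij n))) /=.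
rewrite -(pair_bigA _ (fun i w =>
  \prod_j exc_weight a b (cycle_insert (i, w)) j)) big_ord_recr /= addrC.
congr (_ + _).
  by rewrite mulr_sumr; apply: eq_bigr => w _; rewrite prod_cycle_insert_max.
rewrite exchange_big /= raddf_sum horner_sum; apply: eq_bigr => w _.
have wt j : (exc_weight (a%:P + (a * b) *: 'X) (b%:P + (a * b) *: 'X) w j).[0]
            = exc_weight a b w j.
  by rewrite /exc_weight; case: ifP => _; rewrite horner_line0.
have dwt j : (exc_weight (a%:P + (a * b) *: 'X) (b%:P + (a * b) *: 'X) w j)^`()
            = (a * b)%:P.
  by rewrite /exc_weight; case: ifP => _; rewrite deriv_line.
rewrite /= deriv_prod horner_sum; apply: eq_bigr => i _.
have -> : widen_ord (leqnSn n) i = lift ord_max i.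
  by apply: ord_inj; rewrite lift_max.
rewrite prod_cycle_insert_lift dwt hornerM hornerC horner_prod.
by congr (_ * _); apply: eq_bigr => j _; rewrite wt.
Qed.

(** * Expansion of the Eulerian polynomial in [a * b] and [a + b] *)

(* The coefficient of [(a b)^k (a + b)^(n - 2k)] in the [n]-th polynomial; the
   recurrence is the action of the derivation with [u' = u v] and [v' = 2 u]
   on [u^k v^(n - 2k)]. *)
Fixpoint eulerian_gamma (n k : nat) : nat :=
  if n is m.+1 then
    k.+1 * eulerian_gamma m k +
    (if k is l.+1 then 2 * (m - 2 * l) * eulerian_gamma m l else 0)
  else k == 0.

(** Makes the truncated exponents [n - 2 * k] in [gamma_sum] harmless. *)
Lemma eulerian_gamma_small (n k : nat) : (n < 2 * k)%N -> eulerian_gamma n k = 0%N.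
Proof.
elim: n k => [|n IHn] [|k] //= nk; rewrite IHn; last by lia.
by rewrite (_ : (n - 2 * k = 0)%N) ?muln0 //; lia.
Qed.

Definition gamma_sum (A : comNzRingType) (n : nat) (u v : A) : A :=
  \sum_(k < n.+1) u ^+ k * v ^+ (n - 2 * k) *+ eulerian_gamma n k.

Lemma horner_gamma_sum (A : comNzRingType) (n : nat) (U V : {poly A}) (x : A) :
  (gamma_sum n U V).[x] = gamma_sum n U.[x] V.[x].
Proof.
by rewrite horner_sum; apply: eq_bigr => k _; rewrite hornerMn hornerM !horner_exp.
Qed.

(** [U] and [V] are first-order deformations of [u] and [v] encoding [D u = u v], [D v = 2 u]. In
    [u^k v^(n - 2k)], the factor [v] and [D u^k] together give [k + 1], and [D v^(n - 2k)] gives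
    [2 (n - 2k)]. *)
Lemma gamma_sum_deriv (A : comNzRingType) (n : nat) (u v : A) (U V : {poly A}) :
    U.[0] = u -> U^`().[0] = u * v -> V.[0] = v -> V^`().[0] = u *+ 2 ->
  v * gamma_sum n u v + (gamma_sum n U V)^`().[0] = gamma_sum n.+1 u v.
Proof.
move=> U0 dU V0 dV; rewrite /gamma_sum.
transitivity (\sum_(k < n.+1) (u ^+ k * v ^+ (n.+1 - 2 * k) *+ (k.+1 * eulerian_gamma n k)) +
  \sum_(k < n.+1) (u ^+ k.+1 * v ^+ (n.+1 - 2 * k.+1) *+ (2 * (n - 2 * k) * eulerian_gamma n k))).
  rewrite mulr_sumr raddf_sum horner_sum -!big_split; apply: eq_bigr => -[k kn] _ /=.
  rewrite derivMn derivM !deriv_exp !(hornerMn, hornerD, hornerM, horner_exp).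
  rewrite U0 dU V0 dV.
  have [nk|kn2] := ltnP n (2 * k); first by rewrite eulerian_gamma_small // !muln0 !mulr0n mulr0 !addr0.
  rewrite !(mulrnA _ _ (eulerian_gamma n k)) mulrnAr -!mulrnDl; congr (_ *+ _).
  rewrite subSn // exprS.
  have -> : (n.+1 - 2 * k.+1 = (n - 2 * k).-1)%N by lia.
  case: (n - 2 * k)%N => [|m] /=; case: k {kn kn2} => [|k] /=; rewrite ?exprS; ring.
under [RHS]eq_bigr do rewrite /= mulrnDr.
rewrite big_split /= [X in _ = X + _]big_ord_recr /= (eulerian_gamma_small (k := n.+1)); last by lia.
rewrite muln0 mulr0n addr0; congr (_ + _).
by rewrite [RHS]big_ord_recl mulr0n add0r; apply: eq_bigr => k _; rewrite lift0.
Qed.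

(** The ring varies in the induction, since the recurrence uses the previous polynomial over
    [{poly A}]. *)
Lemma eulerian_hom_gamma (n : nat) (A : comNzRingType) (a b : A) :
  eulerian_hom n.+1 a b = b * gamma_sum n (a * b) (a + b).
Proof.
elim: n A a b => [|n IHn] A a b.
  rewrite eulerian_homS /eulerian_hom /gamma_sum big_ord_recl big_ord0.
  under eq_bigr do rewrite big_ord0.
  under [in X in X^`()]eq_bigr do rewrite big_ord0.
  rewrite !sumr_const card_Sn /= !expr0 derivC horner0 fact0; ring.
(* With [Q] the previous sum, [b (b Q) + D (b Q) = b ((a + b) Q + D Q)], because [D b = a b]. *)
rewrite eulerian_homS !IHn derivM hornerD !hornerM deriv_line hornerC horner_line0.
rewrite horner_gamma_sum hornerD hornerM !horner_line0.
rewrite -(@gamma_sum_deriv _ n (a * b) (a + b)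
  ((a%:P + (a * b) *: 'X) * (b%:P + (a * b) *: 'X))
  (a%:P + (a * b) *: 'X + (b%:P + (a * b) *: 'X))); first by ring.
- by rewrite hornerM !horner_line0.
- by rewrite derivM !deriv_line hornerD !hornerM !horner_line0 !hornerC; ring.
- by rewrite hornerD !horner_line0.
- by rewrite derivD !deriv_line hornerD !hornerC mulr2n.
Qed.

(** * Signed permutations as permutations with signs *)

Lemma count_ord_set (n : nat) (P : pred 'I_n) : #|[set i | P i]| = (\sum_i P i)%N.
Proof. by rewrite -sum1_card big_mkcond; apply: eq_bigr => i _; rewrite inE; case: (P i). Qed.

(* [we.1] permutes the absolute values, [we.2] gives the signs. *)
Definition signed_fun (n : nat) (we : 'S_n * {ffun 'I_n -> bool}) (a : pm n) : pm n :=
  (a.1 (+) we.2 a.2, we.1 a.2).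

Lemma signed_fun_inj (n : nat) (we : 'S_n * {ffun 'I_n -> bool}) :
  injective (signed_fun we).
Proof.
by move=> [b i] [c j] [/= + /perm_inj ij]; rewrite ij => /addIb ->.
Qed.

Definition signed_of (n : nat) (we : 'S_n * {ffun 'I_n -> bool}) : {perm pm n} :=
  perm (@signed_fun_inj n we).

Lemma signed_of_inj (n : nat) : injective (@signed_of n).
Proof.
move=> [w e] [v f] /permP eq_wv.
have {}eq_wv i : (e i, w i) = (f i, v i).
  by have := eq_wv (false, i); rewrite !permE.
by congr (_, _); [apply/permP | apply/ffunP] => i; case: (eq_wv i).
Qed.

Lemma signed_of_image (n : nat) :
  [set signed_of we | we in [set: 'S_n * {ffun 'I_n -> bool}]] = signed_perm n.
Proof.
apply/setP=> s; apply/imsetP/idP => [[we _ ->]|].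
  rewrite inE; apply/forallP => -[b i].
  by rewrite !permE /signed_fun /pm_opp /= addNb.
rewrite inE => /forallP sP.
(* Equal absolute values give [s i = s j] or [s i = s (- j)]; the latter is impossible as [i] and
   [- j] have opposite signs. *)
have s_inj : injective (fun i => (s (pm_pos i)).2).
  move=> i j eq2; have [eq1|] := eqVneq (s (pm_pos i)).1 (s (pm_pos j)).1.
    have : s (pm_pos i) = s (pm_pos j).
      by rewrite [LHS]surjective_pairing [RHS]surjective_pairing eq1 eq2.
    by move/perm_inj => [].
  move=> ne1; have : s (pm_pos i) = s (pm_opp (pm_pos j)).
    rewrite (eqP (sP _)) [LHS]surjective_pairing /pm_opp eq2.
    by move: ne1; do 2!case: (_.1).
  by move/perm_inj.
exists (perm s_inj, [ffun i => (s (pm_pos i)).1]); rewrite ?inE //.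
apply/permP => -[[] i]; rewrite !permE /signed_fun /= ffunE permE.
  have -> : (true, i) = pm_opp (pm_pos i) by [].
  by rewrite (eqP (sP _)).
by rewrite -surjective_pairing.
Qed.

Lemma exc_signed_of (n : nat) (w : 'S_n) (e : {ffun 'I_n -> bool}) :
  exc_A (signed_of (w, e)) = (\sum_i (~~ e i && (i < w i)%N))%N.
Proof.
rewrite /exc_A count_ord_set; apply: eq_bigr => i _; rewrite permE /signed_fun /=.
by rewrite /pm_val /=; case: (e i) => /=; lia.
Qed.

Lemma neg_signed_of (n : nat) (w : 'S_n) (e : {ffun 'I_n -> bool}) :
  neg (signed_of (w, e)) = (\sum_i e i)%N.
Proof.
rewrite /neg count_ord_set; apply: eq_bigr => i _; rewrite permE /signed_fun /=.
by rewrite /pm_val /=; case: (e i) => /=; lia.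
Qed.

(** For fixed [w] the signs are independent, so the sum over them factors letter by letter. *)
Lemma fexc_poly_eulerian (R : realType) (n : nat) (p : R) :
  fexc_poly n p = eulerian_hom n ('X^2 + p *: 'X) (1 + p *: 'X).
Proof.
rewrite /fexc_poly -signed_of_image big_imset /=; last by move=> ? ? _ _ /signed_of_inj.
transitivity (\sum_(w : 'S_n) \sum_(e : {ffun 'I_n -> bool})
    p ^+ neg (signed_of (w, e)) *: 'X^(fexc (signed_of (w, e))) : {poly R}).
  by rewrite pair_bigA; apply: eq_big => [we|[w e] _] //; rewrite inE.
apply: eq_bigr => w _.
pose f (i : 'I_n) (b : bool) : {poly R} :=
  if b then p *: 'X else if (i < w i)%N then 'X^2 else 1.
transitivity (\prod_i \sum_b f i b).
  rewrite bigA_distr_bigA; apply: eq_bigr => e _.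
  rewrite /fexc neg_signed_of exc_signed_of exprD exprM.
  rewrite -!prodrXr -mul_polyC rmorph_prod -!big_split /=; apply: eq_bigr => i _.
  by rewrite /f; case: (e i); case: (_ < _)%N; rewrite /= -?mul_polyC; ring.
apply: eq_bigr => i _; rewrite big_bool /f /exc_weight.
by case: ifP => _; rewrite addrC.
Qed.

(** * Gamma-positive polynomials and their closure properties *)

Definition gamma_term (R : realType) (N k : nat) : {poly R} :=
  'X^k * (1 + 'X) ^+ (N - 2 * k).

(** [N] is independent of the number of terms: the two parts of the final expansion have as many
    terms, but [N] is odd in one and even in the other. *)
Definition gamma_comb (R : realType) (N n : nat) (c : 'I_n -> R) : {poly R} :=
  \sum_(k < n) c k *: gamma_term R N k.

(* The centre of symmetry is [m]: the terms are [g_k X^k (1 + X)^(2 m - 2 k)]. *)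
Definition gamma_positive (R : realType) (m : nat) (f : {poly R}) : Prop :=
  exists g : nat -> R, (forall k, 0 <= g k) /\ f = gamma_comb (2 * m) (fun k : 'I_m.+1 => g k).

Lemma gamma_positive_mul (R : realType) (m : nat) (f : {poly R}) (al be : R) :
    0 <= al -> 0 <= be -> gamma_positive m f ->
  gamma_positive m.+1 ((al *: 'X + be *: (1 + 'X) ^+ 2) * f).
Proof.
move=> al0 be0 [g [g0 ->]].
(* The factor [X] shifts the coefficients and [(1 + X)^2] keeps their index; the cutoff at [m]
   discards values of [g] outside the sum. *)
exists (fun k => (if k is l.+1 then al * g l else 0) +
                 (if (k <= m)%N then be * g k else 0)); split=> [k|].
  by apply: addr_ge0; [case: k => // k | case: ifP => // _]; apply: mulr_ge0.
rewrite /gamma_comb /gamma_term; under [RHS]eq_bigr do rewrite scalerDl.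
rewrite big_split /= mulrDl; congr (_ + _).
  rewrite [RHS]big_ord_recl scale0r add0r mulr_sumr; apply: eq_bigr => k _.
  rewrite lift0 -!mul_polyC polyCM exprS.
  have -> : (2 * m.+1 - 2 * k.+1 = 2 * m - 2 * k)%N by lia.
  ring.
rewrite [RHS]big_ord_recr /= ltnn scale0r addr0 mulr_sumr; apply: eq_bigr => k _.
rewrite -ltnS ltn_ord -!mul_polyC polyCM.
have -> : (2 * m.+1 - 2 * k = (2 * m - 2 * k) + 2)%N by have := ltn_ord k; lia.
by rewrite exprD; ring.
Qed.

Lemma gamma_positive0 (R : realType) (m : nat) : gamma_positive m (0 : {poly R}).
Proof.
exists (fun=> 0); split=> //.
by rewrite /gamma_comb /gamma_term big1 // => k _; rewrite scale0r.
Qed.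

Lemma gamma_positive_sum (R : realType) (m : nat) (I : Type) (r : seq I)
    (f : I -> {poly R}) :
  (forall i, gamma_positive m (f i)) -> gamma_positive m (\sum_(i <- r) f i).
Proof.
move=> fP; elim: r => [|i r [g [g0 gE]]].
  by rewrite big_nil; apply: gamma_positive0.
have [h [h0 hE]] := fP i; rewrite big_cons gE hE.
exists (fun k => h k + g k); split=> [k|]; first exact: addr_ge0.
by rewrite /gamma_comb /gamma_term -big_split; apply: eq_bigr => k _; rewrite scalerDl.
Qed.

Lemma gamma_positive_mulX (R : realType) (m j : nat) (f : {poly R}) (al be : R) :
    0 <= al -> 0 <= be -> gamma_positive m f ->
  gamma_positive (j + m) ((al *: 'X + be *: (1 + 'X) ^+ 2) ^+ j * f).
Proof.
move=> al0 be0 fP; elim: j => [|j IHj]; first by rewrite mul1r.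
by rewrite exprS -mulrA addSn; apply: gamma_positive_mul.
Qed.

Lemma gamma_positive1 (R : realType) : gamma_positive 0 (1 : {poly R}).
Proof.
exists (fun=> 1); split=> //.
by rewrite /gamma_comb /gamma_term big_ord_recl big_ord0 !expr0 mulr1 scale1r addr0.
Qed.

Lemma gamma_positive_muln (R : realType) (m c : nat) (f : {poly R}) :
  gamma_positive m f -> gamma_positive m (f *+ c).
Proof.
move=> [g [g0 ->]]; exists (fun k => g k *+ c); split=> [k|].
  by rewrite mulrn_wge0.
by rewrite /gamma_comb /gamma_term -sumrMnl; apply: eq_bigr => k _; rewrite scalerMnl.
Qed.

Lemma gamma_sum_gamma_positive (R : realType) (m : nat) (p : R) :
    1 <= p ->
  gamma_positive m (gamma_sum m (('X^2 + p *: 'X) * (1 + p *: 'X))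
                                ('X^2 + p *: 'X + (1 + p *: 'X))).
Proof.
move=> hp; apply: gamma_positive_sum => k.
have [mk|km] := ltnP m (2 * k).
  by rewrite eulerian_gamma_small // mulr0n; apply: gamma_positive0.
apply: gamma_positive_muln.
have -> : ('X^2 + p *: 'X) * (1 + p *: 'X) =
    (1 *: 'X + 0 *: (1 + 'X) ^+ 2) *
    ((p - 1) ^+ 2 *: 'X + p *: (1 + 'X) ^+ 2) :> {poly R}.
  by rewrite -!mul_polyC !(rmorphXn, rmorphB, rmorph0, rmorph1) /=; ring.
have -> : 'X^2 + p *: 'X + (1 + p *: 'X) =
    (2 * (p - 1)) *: 'X + 1 *: (1 + 'X) ^+ 2 :> {poly R}.
  by rewrite -!mul_polyC !(rmorphM, rmorphB, rmorph_nat, rmorph1) /=; ring.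
rewrite exprMn -mulrA -[_ ^+ (m - _)]mulr1.
(* Each of the [k] factors [u] counts twice, being [X] times a quadratic factor; each [v] counts
   once, and the constant 1 has centre 0. *)
have {1}-> : m = (k + (k + ((m - 2 * k) + 0)))%N by lia.
apply: gamma_positive_mulX => //; apply: gamma_positive_mulX; try lra.
  exact: sqr_ge0.
apply: gamma_positive_mulX; try lra.
exact: gamma_positive1.
Qed.

(** * Symmetry and monotonicity of the coefficients *)

(** From [(k + 1) C(n, k + 1) = (n - k) C(n, k)] and [k + 1 <= n - k]. *)
Lemma bin_leq_step (n k : nat) : (2 * k < n)%N -> ('C(n, k) <= 'C(n, k.+1))%N.
Proof.
move=> kn; rewrite -(leq_pmul2l (ltn0Sn k)) mul_bin_left leq_mul2r.
by apply/orP; right; lia.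
Qed.

Lemma coef_add1X (R : realType) (j i : nat) :
  ((1 + 'X) ^+ j : {poly R})`_i = ('C(j, i))%:R.
Proof.
rewrite exprDn coef_sum; have [ij|ij] := ltnP i j.+1.
  rewrite (bigD1 (Ordinal ij)) //= expr1n mul1r coefMn coefXn eqxx big1 ?addr0 // => k.
  by rewrite -val_eqE /= expr1n mul1r coefMn coefXn eq_sym => /negbTE ->; rewrite mul0rn.
rewrite bin_small // big1 // => k _.
rewrite expr1n mul1r coefMn coefXn gtn_eqF ?mul0rn //.
exact: leq_trans (ltn_ord k) ij.
Qed.

Lemma coef_gamma_term (R : realType) (N k i : nat) :
  (gamma_term R N k)`_i = if (i < k)%N then 0 else ('C(N - 2 * k, i - k))%:R.
Proof. by rewrite coefXnM coef_add1X. Qed.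

Lemma gamma_term_sym (R : realType) (N k i : nat) :
  (2 * k <= N)%N -> (i <= N)%N -> (gamma_term R N k)`_(N - i) = (gamma_term R N k)`_i.
Proof.
move=> kN iN; rewrite !coef_gamma_term.
(* If just one of [i], [N - i] is below [k], the other lies above [N - k], where the binomial
   vanishes. *)
case: ifP => i1; case: ifP => i2 //.
- by rewrite bin_small //; lia.
- by rewrite bin_small //; lia.
rewrite -[in RHS]bin_sub; last by lia.
by congr (_%:R); congr 'C(_, _); lia.
Qed.

Lemma gamma_term_ge0 (R : realType) (N k i : nat) : 0 <= (gamma_term R N k)`_i.
Proof. by rewrite coef_gamma_term; case: ifP. Qed.

Lemma gamma_term_step (R : realType) (N k i : nat) :
  (2 * k <= N)%N -> (2 * i < N)%N ->
  (gamma_term R N k)`_i <= (gamma_term R N k)`_i.+1.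
Proof.
move=> kN iN; rewrite [leLHS]coef_gamma_term.
case: ltnP => ik; first exact: gamma_term_ge0.
rewrite coef_gamma_term ltnNge leqW //= ler_nat subSn //.
by apply: bin_leq_step; lia.
Qed.

Lemma gamma_term_large (R : realType) (N k i : nat) :
  (2 * k <= N)%N -> (N < i)%N -> (gamma_term R N k)`_i = 0.
Proof.
by move=> kN iN; rewrite coef_gamma_term bin_small ?if_same //; lia.
Qed.

Lemma coef_gamma_comb (R : realType) (N n i : nat) (c : 'I_n -> R) :
  (gamma_comb N c)`_i = \sum_(k < n) c k * (gamma_term R N k)`_i.
Proof. by rewrite coef_sum; apply: eq_bigr => k _; rewrite coefZ. Qed.

(** The bound [2 * n <= N.+2] ensures [2 * k <= N] for all [k < n], so no exponent is truncated. *)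
Lemma gamma_comb_sym (R : realType) (N n i : nat) (c : 'I_n -> R) :
  (2 * n <= N.+2)%N -> (i <= N)%N -> (gamma_comb N c)`_(N - i) = (gamma_comb N c)`_i.
Proof.
move=> nN iN; rewrite !coef_gamma_comb; apply: eq_bigr => k _.
by rewrite gamma_term_sym //; have := ltn_ord k; lia.
Qed.

Lemma gamma_comb_ge0 (R : realType) (N n i : nat) (c : 'I_n -> R) :
  (forall k, 0 <= c k) -> 0 <= (gamma_comb N c)`_i.
Proof.
move=> c0; rewrite coef_gamma_comb; apply: sumr_ge0 => k _.
by rewrite mulr_ge0 ?gamma_term_ge0.
Qed.

Lemma gamma_comb_step (R : realType) (N n i : nat) (c : 'I_n -> R) :
    (forall k, 0 <= c k) -> (2 * n <= N.+2)%N -> (2 * i < N)%N ->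
  (gamma_comb N c)`_i <= (gamma_comb N c)`_i.+1.
Proof.
move=> c0 nN iN; rewrite !coef_gamma_comb; apply: ler_sum => k _.
by rewrite ler_wpM2l // gamma_term_step //; have := ltn_ord k; lia.
Qed.

Lemma gamma_comb_large (R : realType) (N n i : nat) (c : 'I_n -> R) :
  (2 * n <= N.+2)%N -> (N < i)%N -> (gamma_comb N c)`_i = 0.
Proof.
move=> nN iN; rewrite coef_gamma_comb big1 // => k _.
by rewrite gamma_term_large ?mulr0 //; have := ltn_ord k; lia.
Qed.

(** * The bi-gamma expansion and the alternating inequalities *)

Lemma eulerian_gamma0 (n : nat) : eulerian_gamma n 0 = 1%N.
Proof. by elim: n => //= n ->. Qed.

(** At [X = 0] one has [u = 0] and [b = v = 1], so only the term [k = 0] survives. *)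
Lemma fexc_poly_coef0 (R : realType) (n : nat) (p : R) : (fexc_poly n.+1 p)`_0 = 1.
Proof.
rewrite -horner_coef0 fexc_poly_eulerian eulerian_hom_gamma hornerM.
rewrite horner_gamma_sum !hornerE /= expr0n /= add0r addr0.
rewrite /gamma_sum big_ord_recl big1 => [|k _].
  by rewrite eulerian_gamma0 !expr0 expr1n mul1r addr0.
by rewrite expr0n mul0r mul0rn.
Qed.

Lemma fexc_poly_bi_gamma (R : realType) (n : nat) (p : R) : 1 <= p ->
  exists xi eta : 'I_n.+1 -> R,
    [/\ forall k, 0 <= xi k, forall k, 0 <= eta k &
        fexc_poly n.+1 p = gamma_comb (2 * n.+1 - 1) xi
                         + 'X * gamma_comb (2 * n.+1 - 2) eta].
Proof.
move=> hp; have [g [g0 gE]] := gamma_sum_gamma_positive n hp.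
(* Both parts come from the gamma vector of [Q_n], multiplied by [1 + X] and by [(p - 1) X]. *)
exists (fun k => g k), (fun k => (p - 1) * g k); split=> // [k|].
  by rewrite mulr_ge0 // subr_ge0.
rewrite fexc_poly_eulerian eulerian_hom_gamma gE.
have -> : 1 + p *: 'X = (1 + 'X) + (p - 1) *: 'X :> {poly R}.
  by rewrite scalerBl scale1r; ring.
rewrite mulrDl; congr (_ + _).
  rewrite mulr_sumr; apply: eq_bigr => k _; rewrite -scalerAr; congr (_ *: _).
  rewrite /gamma_term mulrCA -exprS; congr (_ * _ ^+ _).
  by have := ltn_ord k; lia.
rewrite -scalerAl scalerAr; congr (_ * _); rewrite scaler_sumr.
apply: eq_bigr => k _; rewrite scalerA /gamma_term.
by congr (_ *: (_ * _ ^+ _)); lia.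
Qed.

Theorem theorem35 (R : realType) (p : R) (n : nat)
    (hp : 1 <= p) (hn : (1 <= n)%N) :
  let F : {poly R} := fexc_poly n p in
  [/\ size F = (2 * n)%N,
      exists xi eta : 'I_n -> R,
        [/\ forall k, 0 <= xi k,
            forall k, 0 <= eta k
          & F = \sum_(k < n) xi k *: ('X^k * (1 + 'X) ^+ (2 * n - 1 - 2 * k))
                + 'X * \sum_(k < n)
                    eta k *: ('X^k * (1 + 'X) ^+ (2 * n - 2 - 2 * k))],
      forall i : nat, (i < n)%N -> F`_i <= F`_(2 * n - 1 - i)
    & forall i : nat, (i.+1 < n)%N -> F`_(2 * n - 1 - i) <= F`_(i.+1)].
Proof.
case: n hn => // n _ F.
have [xi [eta [xi0 eta0 FE]]] := fexc_poly_bi_gamma n hp; rewrite -/F in FE.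
pose a := gamma_comb (2 * n.+1 - 1) xi; pose b := gamma_comb (2 * n.+1 - 2) eta.
have F0 : F`_0 = a`_0 by rewrite FE coefD coefXM addr0.
have FS i : F`_i.+1 = a`_i.+1 + b`_i by rewrite FE coefD coefXM.
(* The factor [X] puts the centres of [a] and [X b] one half below and above that of the reversal,
   so reversing trades [b_(i-1)] for [b_i]. The inequalities thus reduce to the growth of [b] and of
   [a] up to their middles. *)
have Frev i : (i < 2 * n.+1 - 1)%N -> F`_(2 * n.+1 - 1 - i) = a`_i + b`_i.
  move=> ni; rewrite FE coefD coefXM gamma_comb_sym; [|lia..].
  have -> : ((2 * n.+1 - 1 - i).-1 = 2 * n.+1 - 2 - i)%N by lia.
  by rewrite ifF ?gamma_comb_sym //; lia.
have incr i : (i < n.+1)%N -> F`_i <= F`_(2 * n.+1 - 1 - i).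
  case: i => [|i] ni; rewrite Frev; [|lia| |lia].
    by rewrite F0 lerDl gamma_comb_ge0.
  by rewrite FS lerD2l gamma_comb_step //; lia.
split=> //; last 1 first.
- move=> i ni; rewrite Frev; last by lia.
  by rewrite FS lerD2r gamma_comb_step //; lia.
- apply/eqP; rewrite eqn_leq; apply/andP; split.
    apply/leq_sizeP => -[|j] nj; first by lia.
    by rewrite FS !gamma_comb_large ?addr0 //; lia.
  (* The top coefficient is at least [F_0 = 1] by the first family of inequalities. *)
  have : 0 < F`_(2 * n.+1 - 1 - 0).
    by apply: lt_le_trans (incr 0%N _); rewrite ?fexc_poly_coef0.
  by apply: contraTleq => Fn; rewrite nth_default ?ltxx // subn0 subn1 -ltnS prednK.
by exists xi, eta.
Qed.
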